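(* Let $M\subset\mathbb{R}^N$ be a closed embedded smooth submanifold with reach $\tau$. If $x,y\in M$ and $|x-y|_{\mathbb{R}^N}<\frac{\tau}{2}$, then $$d_M(x,y)\le 2\,|x-y|_{\mathbb{R}^N}.$$
   Context: Closed submanifold means compact without boundary. $|\cdot|_{\mathbb{R}^N}$ is the Euclidean norm and $d_M$ is the geodesic distance on $M$ for the Riemannian metric induced from $\mathbb{R}^N$. For $p\in\mathbb{R}^N$ let $d(p,M)=\inf_{s\in M}|s-p|_{\mathbb{R}^N}$, let $\pi_M(p)=\{x\in M: |p-x|_{\mathbb{R}^N}=d(p,M)\}$, and for $r\ge 0$ let $U_M^r=\{p\in\mathbb{R}^N:d(p,M)<r\}$. The reach of $M$ is $\tau=\sup\{r\ge0: \pi_M(p)\text{ consists of exactly one point for all }p\in U_M^r\}$. *)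

(* Defs.v *)
From HB Require Import structures.
From mathcomp Require Import all_boot all_order all_algebra.
From mathcomp Require Import all_classical all_reals all_analysis.

Set Implicit Arguments.
Unset Strict Implicit.
Unset Printing Implicit Defensive.

Import Order.TTheory GRing.Theory Num.Theory.
Import numFieldNormedType.Exports.

Local Open Scope classical_set_scope.
Local Open Scope ring_scope.

(* The library norm [`|p|] on ['rV[R]_N] is the sup norm.  It is used below only
   through its topology and the differentiability it induces, which are the
   Euclidean ones; every metric quantity is expressed with [enorm]. *)
Definition enorm (R : realType) (N : nat) (p : 'rV[R]_N) : R :=
  Num.sqrt (\sum_(i < N) p ord0 i ^+ 2).

(* For maps between finite-dimensional spaces and an open [U], this is the
   usual class C^k on [U]: f is of class C^k.+1 iff it is differentiable and
   all its directional derivatives are of class C^k. *)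
Fixpoint class_on (R : realType) (V W : normedModType R) (k : nat)
    (U : set V) (f : V -> W) : Prop :=
  match k with
  | 0 => forall x, U x -> {for x, continuous f}
  | k'.+1 => (forall x, U x -> differentiable f x) /\
             (forall v : V, class_on k' U ('D_v f))
  end.

Definition smooth_on (R : realType) (V W : normedModType R)
    (U : set V) (f : V -> W) : Prop := forall k, class_on k U f.

(* R^m x {0} inside R^N *)
Definition slice (R : realType) (N m : nat) : set 'rV[R]_N :=
  [set q | forall i : 'I_N, (m <= i)%N -> q ord0 i = 0].

(* An m-dimensional embedded submanifold (without boundary) of R^N: around each
   point of M a diffeomorphism [phi : U -> V] of open subsets of R^N, with
   inverse [psi], straightens M to R^m x {0}. *)
Definition embedded_submanifold (R : realType) (m N : nat)
    (M : set 'rV[R]_N) : Prop :=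
  (m <= N)%N /\
  forall p, M p ->
  exists (U V : set 'rV[R]_N) (phi psi : 'rV[R]_N -> 'rV[R]_N),
    [/\ open U, U p & open V] /\
    [/\ smooth_on U phi, smooth_on V psi,
        (forall q, U q -> V (phi q) /\ psi (phi q) = q),
        (forall q, V q -> U (psi q) /\ phi (psi q) = q) &
        phi @` (M `&` U) = V `&` slice m].

Definition closed_submanifold (R : realType) (m N : nat)
    (M : set 'rV[R]_N) : Prop :=
  compact M /\ embedded_submanifold m M.

(* [+oo] when [M] is empty *)
Definition dist_to (R : realType) (N : nat) (p : 'rV[R]_N)
    (M : set 'rV[R]_N) : \bar R :=
  ereal_inf [set (enorm (s - p))%:E | s in M].

Definition nearest (R : realType) (N : nat) (M : set 'rV[R]_N)
    (p : 'rV[R]_N) : set 'rV[R]_N :=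
  [set x | M x /\ (enorm (p - x))%:E = dist_to p M].

Definition tube (R : realType) (N : nat) (M : set 'rV[R]_N) (r : R) :
    set 'rV[R]_N :=
  [set p | (dist_to p M < r%:E)%E].

(* The reach may be [+oo], e.g. when [M] is a point. *)
Definition reach (R : realType) (N : nat) (M : set 'rV[R]_N) : \bar R :=
  ereal_sup [set r%:E | r in [set r : R | 0 <= r /\
    forall p, tube M r p -> exists! x, nearest M p x]].

(* Smoothness on a closed interval, including one-sided smoothness at the
   endpoints, is the existence of a smooth extension to a neighbourhood. *)
Definition smooth_on_itv (R : realType) (N : nat) (a b : R)
    (g : R -> 'rV[R]_N) : Prop :=
  exists (O : set R) (h : R -> 'rV[R]_N),
    [/\ open O, `[a, b]%classic `<=` O, smooth_on (O : set R^o) h &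
        forall t, t \in `[a, b] -> g t = h t].

(* Consecutive closed pieces share an endpoint, so such a [g] is continuous on
   the whole of [a, b]. *)
Definition piecewise_smooth (R : realType) (N : nat) (a b : R)
    (g : R -> 'rV[R]_N) : Prop :=
  exists s : seq R, itv_partition a b s /\
    forall i, (i < size s)%N ->
      smooth_on_itv (nth b (a :: s) i) (nth b s i) g.

(* The metric induced on M is the restriction of the Euclidean inner product to
   tangent vectors, so the speed of a curve in M is the Euclidean norm of its
   velocity in R^N.  The finitely many breakpoints of [g], where [derive1 g] carries
   no information, are negligible. *)
Definition curve_length (R : realType) (N : nat) (a b : R)
    (g : R -> 'rV[R]_N) : \bar R :=
  (\int[lebesgue_measure]_(t in `[a, b]) (enorm (derive1 g t))%:E)%E.

Definition curve_in (R : realType) (N : nat) (M : set 'rV[R]_N)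
    (x y : 'rV[R]_N) (a b : R) (g : R -> 'rV[R]_N) : Prop :=
  [/\ a < b, piecewise_smooth a b g, g a = x, g b = y &
      forall t, t \in `[a, b] -> M (g t)].

(* [+oo] when x and y lie in different connected components of M *)
Definition geodesic_dist (R : realType) (N : nat) (M : set 'rV[R]_N)
    (x y : 'rV[R]_N) : \bar R :=
  ereal_inf [set l | exists (a b : R) (g : R -> 'rV[R]_N),
    curve_in M x y a b g /\ l = curve_length a b g].

(* Main.v *)
Require Import Defs.
From mathcomp Require Import all_boot all_order all_algebra.
From mathcomp Require Import ring lra.
From mathcomp Require Import all_classical all_reals all_analysis.

(** The idea is to push the straight segment from [x] to [y] onto [M] by the
nearest point projection [P], which is Lipschitz with constant [4/3] on that
segment.

Lipschitz bound.  Let [r] be a radius below which nearest points are unique,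
with [2 |x - y| < r], and fix [rho] between the two.  Moving from [p] off [M] away
from [P p], the distance to [M] grows at rate [1] to first order, because almost
nearest points are close to the nearest one ([dist_ascent]).  Maximising the
distance to [M] over a closed ball turns this infinitesimal statement into a
global one: some [q] at distance [l] from [p] has [d q = d p + l] ([dist_max]).
Equality in the triangle inequality places [q] on the ray from [P p] through
[p], so the open ball of radius [rho] tangent to [M] at [P p] on the side of [p]
misses [M] ([le_tangent_ball_dist]).  Expanding squares gives Federer's inequality
[<p - P p, b - P p> <= d(p) |b - P p|^2 / (2 rho)] for [b] in [M]
([federer_inequality]), and adding it for two points yields
[(1 - s / rho) |P p - P q| <= |p - q|] when [d p, d q <= s]
([projection_lipschitz]).  Every point of the segment is within
[s = |x - y| / 2 <= rho / 4] of an endpoint, whence the constant [4/3].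

From the projected segment to a piecewise smooth curve.  The projection itself
is never differentiated.  Instead the segment is cut into [n] equal parts, and
consecutive projections, at distance at most [4/3 |x - y| / n], are joined by
smooth arcs in [M].  Such an arc is the image under a chart inverse of a straight
segment; a [C^1] map being strictly differentiable
([strict_differentiability]), the arc from [p] to [q] is Lipschitz with constant
[3/2 |p - q|] as soon as [p] and [q] are close, uniformly in [p] by compactness
([uniform_arc]).

Length.  The concatenated curve is Lipschitz with constant
[K = 3/2 * 4/3 * |x - y| / n = 2 |x - y| / n] on an interval of length [n]
([concat_arcs]), hence has length at most [2 |x - y|] ([curve_length_le]). *)

Set Implicit Arguments.
Unset Strict Implicit.
Unset Printing Implicit Defensive.

Import Order.TTheory GRing.Theory Num.Theory.
Import numFieldNormedType.Exports.
Local Open Scope classical_set_scope.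
Local Open Scope ring_scope.

(** * The Euclidean inner product and norm *)

Section EuclideanNorm.
Context {R : realType} {N : nat}.
Implicit Types u v w : 'rV[R]_N.

Definition dot u v : R := \sum_(i < N) u ord0 i * v ord0 i.

Lemma dotC u v : dot u v = dot v u.
Proof. by apply: eq_bigr => i _; rewrite mulrC. Qed.

Lemma dotDl u v w : dot (u + v) w = dot u w + dot v w.
Proof. by rewrite -big_split; apply: eq_bigr => i _; rewrite mxE mulrDl. Qed.

Lemma dotZl k u w : dot (k *: u) w = k * dot u w.
Proof. by rewrite mulr_sumr; apply: eq_bigr => i _; rewrite mxE mulrA. Qed.

Lemma dotNl u w : dot (- u) w = - dot u w.
Proof. by rewrite -scaleN1r dotZl mulN1r. Qed.

Lemma dotDr u v w : dot u (v + w) = dot u v + dot u w.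
Proof. by rewrite dotC dotDl !(dotC u). Qed.

Lemma dotZr k u w : dot u (k *: w) = k * dot u w.
Proof. by rewrite dotC dotZl dotC. Qed.

Lemma dotNr u w : dot u (- w) = - dot u w.
Proof. by rewrite dotC dotNl dotC. Qed.

Lemma enorm_ge0 u : 0 <= enorm u. Proof. exact: sqrtr_ge0. Qed.

Lemma dotuu u : dot u u = enorm u ^+ 2.
Proof.
rewrite sqr_sqrtr; first by apply: eq_bigr => i _; rewrite expr2.
by apply: sumr_ge0 => i _; exact: sqr_ge0.
Qed.

Lemma coord_le_enorm u i : `|u ord0 i| <= enorm u.
Proof.
rewrite -sqrtr_sqr ler_wsqrtr // (bigD1 i) //= lerDl.
by apply: sumr_ge0 => j _; exact: sqr_ge0.
Qed.

Lemma enorm0_eq0 u : enorm u = 0 -> u = 0.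
Proof.
move=> u0; apply/rowP => i; rewrite mxE; apply/eqP.
by rewrite -normr_le0 -u0 coord_le_enorm.
Qed.

Lemma enormZ k u : enorm (k *: u) = `|k| * enorm u.
Proof.
apply/eqP; rewrite -(@eqrXn2 _ 2) ?mulr_ge0 ?enorm_ge0 //.
by rewrite exprMn -!dotuu dotZl dotZr mulrA real_normK ?num_real // expr2.
Qed.

Lemma enormN u : enorm (- u) = enorm u.
Proof. by rewrite -scaleN1r enormZ normrN1 mul1r. Qed.

Lemma enormB u v : enorm (u - v) = enorm (v - u).
Proof. by rewrite -enormN opprB. Qed.

Lemma enorm0 : enorm (0 : 'rV[R]_N) = 0.
Proof. by rewrite -(scale0r 0) enormZ normr0 mul0r. Qed.

Lemma sqr_enormD u v :
  enorm (u + v) ^+ 2 = enorm u ^+ 2 + 2 * dot u v + enorm v ^+ 2.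
Proof. rewrite -!dotuu !(dotDl, dotDr) (dotC v u); ring. Qed.

Lemma dot_le u v : dot u v <= enorm u * enorm v.
Proof.
have [v0|v0] := eqVneq (enorm v) 0.
  rewrite v0 (enorm0_eq0 v0) mulr0 /dot big1 // => i _.
  by rewrite mxE mulr0.
have v_gt0 : 0 < enorm v by rewrite lt_def v0 enorm_ge0.
have := sqr_ge0 (enorm (enorm v ^+ 2 *: u + (- dot u v) *: v)).
rewrite sqr_enormD !enormZ !exprMn !real_normK ?num_real // dotZl dotZr.
set a := enorm u; set b := enorm v; set c := dot u v => h.
have a0 : 0 <= a := enorm_ge0 u.
rewrite -/b in v_gt0.
have : 0 <= b ^+ 2 * ((a * b) ^+ 2 - c ^+ 2).
  apply: le_trans h _; rewrite le_eqVlt; apply/orP; left; apply/eqP; ring.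
rewrite pmulr_rge0 ?exprn_gt0 // subr_ge0 => h2.
case: (ltP c 0) => c0; first by rewrite (le_trans (ltW c0)) ?mulr_ge0 // ltW.
by rewrite -(@ler_pXn2r _ 2) ?nnegrE ?mulr_ge0 // ltW.
Qed.

Lemma enormD u v : enorm (u + v) <= enorm u + enorm v.
Proof.
have u0 := enorm_ge0 u; have v0 := enorm_ge0 v; have uv0 := enorm_ge0 (u + v).
rewrite -(@ler_pXn2r _ 2) ?nnegrE ?addr_ge0 // sqr_enormD.
have := dot_le u v; nra.
Qed.

Lemma enorm_tri u v w : enorm (u - w) <= enorm (u - v) + enorm (v - w).
Proof. by rewrite -{1}(subrKA v) enormD. Qed.

(** The next three lemmas compare [enorm] with the sup norm, which carries the
topology and the differential calculus. *)
Lemma norm_le_enorm u : `|u| <= enorm u.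
Proof.
rewrite /Num.Def.normr /= mx_normrE; apply: bigmax_le; first exact: enorm_ge0.
by move=> [i j] _ /=; rewrite ord1 coord_le_enorm.
Qed.

Lemma coord_le_norm u i : `|u ord0 i| <= `|u|.
Proof.
rewrite [leRHS]/Num.Def.normr /= mx_normrE.
exact: (le_bigmax _ (fun ij => `|u ij.1 ij.2|) (ord0, i)).
Qed.

Lemma enorm_le_norm u : enorm u <= N%:R * `|u|.
Proof.
rewrite -(@ler_pXn2r _ 2) ?nnegrE ?enorm_ge0 ?mulr_ge0 // -dotuu.
apply: (@le_trans _ _ (\sum_(i < N) `|u| ^+ 2)).
  apply: ler_sum => i _; rewrite -expr2 -real_normK ?num_real //.
  by rewrite lerXn2r ?nnegrE ?coord_le_norm.
rewrite sumr_const card_ord exprMn -[_ *+ _]mulr_natl ler_wpM2r ?sqr_ge0 //.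
by rewrite -natrX ler_nat; case: (N) => // n; rewrite expnS expn1 leq_pmull.
Qed.

Lemma enorm_continuous : continuous (@enorm R N).
Proof.
move=> u; apply/(@cvgrPdist_lt _ _ _ (nbhs u) (nbhs_filter u)) => e e0.
have Np : 0 < N%:R + 1 :> R by rewrite ltr_wpDl.
have := @nbhsx_ballx _ _ u _ (divr_gt0 e0 Np); apply: filterS => v.
rewrite -ball_normE /= ltr_pdivlMr // mulrC; apply: le_lt_trans.
apply: (@le_trans _ _ (enorm (u - v))).
  have := enorm_tri u v 0; have := enorm_tri v u 0.
  by rewrite (enormB v u) !subr0 => h1 h2; rewrite ler_norml; lra.
by apply: (le_trans (enorm_le_norm _)); rewrite ler_wpM2r // lerDl.
Qed.

End EuclideanNorm.

(** * Length of Lipschitz curves *)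

(** Where the difference quotients converge, the limit inherits their bound; where
they diverge, as at breakpoints of a piecewise smooth curve, [derive1] takes the
default value [0]. *)
Lemma enorm_derive1_le (R : realType) (N : nat) (g : R -> 'rV[R]_N) (K t : R) :
  (forall s u, enorm (g s - g u) <= K * `|s - u|) -> enorm (derive1 g t) <= K.
Proof.
move=> gK.
have K0 : 0 <= K.
  by have := gK 1 0; rewrite subr0 normr1 mulr1; apply: le_trans; exact: enorm_ge0.
rewrite /derive1; set F := (X in lim X).
have [cF|ncF] := pselect (cvg F); last first.
  have -> : lim F = 0.
    rewrite /lim /lim_in getPN; last by move=> l Fl; apply: ncF; apply/cvg_ex; exists l.
    by apply/matrixP => i j; rewrite !mxE.
  by rewrite enorm0.
apply: (@closed_cvg _ _ _ _ _ [set u : 'rV[R]_N | enorm u <= K] _ _ _ cF).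
- apply: (@closed_comp _ _ (@enorm R N) [set x : R | x <= K]); last exact: closed_le.
  by move=> x _; exact: enorm_continuous.
- near=> h.
  have h0 : h != 0 by near: h; exact: nbhs_dnbhs_neq.
  rewrite /= enormZ normfV ler_pdivrMl ?normr_gt0 // mulrC.
  by apply: (le_trans (gK _ _)); rewrite addrK.
Unshelve. all: by end_near. Qed.

(** The integral of a nonnegative function is a supremum over simple functions
below it, so it is monotone on arbitrary functions, such as a speed whose
measurability is not known. *)
Lemma ge0_le_integral_set d (T : measurableType d) (R : realType)
    (mu : {measure set T -> \bar R}) (D : set T) (f h : T -> \bar R) :
  (forall x, D x -> (0 <= f x)%E) -> (forall x, D x -> (f x <= h x)%E) ->
  (\int[mu]_(x in D) f x <= \int[mu]_(x in D) h x)%E.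
Proof.
move=> f0 fh.
have h0 x : D x -> (0 <= h x)%E by move=> Dx; apply: le_trans (fh _ Dx); exact: f0.
rewrite !ge0_integralE //.
apply: ereal_sup_le => _ [k kf <-]; exists k => // x.
apply: le_trans (kf x) _; rewrite !patchE.
by case: ifPn => // /set_mem Dx; exact: fh.
Qed.

Lemma curve_length_le (R : realType) (N : nat) (g : R -> 'rV[R]_N) (K a b : R) :
  a <= b -> (forall s u, enorm (g s - g u) <= K * `|s - u|) ->
  (curve_length a b g <= (K * (b - a))%:E)%E.
Proof.
move=> ab gK; rewrite /curve_length.
apply: (@le_trans _ _ (\int[lebesgue_measure]_(t in `[a, b]) K%:E)%E).
  apply: ge0_le_integral_set => t _; first by rewrite lee_fin enorm_ge0.
  by rewrite lee_fin enorm_derive1_le.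
rewrite integral_cst //= lebesgue_measure_itv /= lte_fin EFinM.
case: ltP => ba; first by rewrite EFinB.
by rewrite (_ : b - a = 0) //; lra.
Qed.

(** * The nearest point projection in a tube *)

Lemma enormBl_continuous (R : realType) (N : nat) (v : 'rV[R]_N) :
  continuous (fun s : 'rV[R]_N => enorm (v - s)).
Proof.
move=> s; apply: (@continuous_comp _ _ _ (fun s : 'rV[R]_N => v - s) (@enorm R N) s).
  by apply: (@continuousB _ _ _ (cst v) id s); [exact: cst_continuous|exact: cvg_id].
exact: enorm_continuous.
Qed.

Section Projection.
Context {R : realType} {N : nat}.
Implicit Types p q a b s : 'rV[R]_N.
Variables (M : set 'rV[R]_N) (P : 'rV[R]_N -> 'rV[R]_N).
Hypothesis cM : compact M.
Hypothesis MP : forall p, M (P p).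
Hypothesis Pmin : forall p s, M s -> enorm (p - P p) <= enorm (p - s).

Let d p : R := enorm (p - P p).

Lemma dist_lipschitz p q : d p <= d q + enorm (p - q).
Proof.
apply: le_trans (Pmin p (MP q)) _; rewrite [leRHS]addrC; exact: enorm_tri.
Qed.

Lemma dist_continuous : continuous d.
Proof.
move=> u; apply/(@cvgrPdist_le _ _ _ (nbhs u) (nbhs_filter u)) => e e0.
have : \forall v \near u, `|enorm (u - v) - enorm (u - u)| < e.
  have /(@cvgrPdist_lt _ _ _ (nbhs u) (nbhs_filter u)) /(_ e e0) :
      (fun v => enorm (u - v)) @ u --> enorm (u - u) by exact: enormBl_continuous.
  by apply: filterS => v; rewrite distrC.
apply: filterS => v; rewrite subrr enorm0 subr0 ger0_norm ?enorm_ge0 // => uv.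
have := dist_lipschitz u v; have := dist_lipschitz v u; rewrite (enormB v u) => h1 h2.
by rewrite ler_norml; lra.
Qed.

(** By compactness, the points of [M] at distance at least [eta] from the unique
nearest point [P q] stay away from [q] by strictly more than [d q]. *)
Lemma almost_nearest_close q (eta : R) :
  (forall s, M s -> enorm (q - s) = d q -> s = P q) -> 0 < eta ->
  exists2 del : R, 0 < del &
    forall s, M s -> enorm (q - s) < d q + del -> enorm (P q - s) < eta.
Proof.
move=> uq eta0.
pose A := M `&` [set s | eta <= enorm (P q - s)].
have cf := @enormBl_continuous R N.
have cA : compact A.
  apply: compact_closedI => //.
  apply: (@closed_comp _ _ (fun s => enorm (P q - s)) [set x : R | eta <= x]).
    by move=> x _; exact: cf.
  exact: closed_ge.
have [A0|A0] := pselect (A !=set0); last first.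
  exists 1 => // s Ms _; rewrite ltNge; apply/negP => h; apply: A0.
  by exists s.
have [|c cA' cmin] := compact_EVT_min A0 cA (f := fun s => enorm (q - s)).
  by apply: continuous_subspaceT; exact: cf.
have [Mc /= cfar] := set_mem cA'.
have dc : d q < enorm (q - c).
  rewrite lt_def Pmin // andbT; apply/eqP => /uq - /(_ Mc) cP.
  by move: cfar; rewrite cP subrr enorm0 leNgt eta0.
exists (enorm (q - c) - d q); first by rewrite subr_gt0.
move=> s Ms; rewrite addrCA subrr addr0 => sc; rewrite ltNge; apply/negP => h.
have /cmin : s \in A by apply/mem_set.
by rewrite leNgt sc.
Qed.

Variables (r : R).
Hypothesis Puniq : forall p, d p < r ->
  forall s, M s -> enorm (p - s) = d p -> s = P p.

(** At distance [h] from [q] along the unit vector [u] pointing away from [P q],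
the nearest point [s] is close to [P q], so [<u, q - s>] is close to [d q] and
[d q' ^ 2 = |q - s|^2 + 2 h <u, q - s> + h^2] is close to [(d q + h)^2] or larger. *)
Lemma dist_ascent q (c l : R) : 0 < d q < r -> 0 < c < 1 -> 0 < l ->
  exists q', [/\ 0 < enorm (q' - q), enorm (q' - q) <= l &
    d q + c * enorm (q' - q) <= d q'].
Proof.
move=> /andP[dq0 dqr] /andP[c0 c1] l0.
pose u := (d q)^-1 *: (q - P q).
have nu : enorm u = 1.
  by rewrite /u enormZ ger0_norm ?invr_ge0 ?(ltW dq0) // mulVf // gt_eqF.
have [|del del0 Pdel] := almost_nearest_close (Puniq dqr) (eta := (1 - c) * d q).
  by rewrite mulr_gt0 // subr_gt0.
(* [|q - s| <= d q + 2 h], which must stay below [d q + del]. *)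
pose h := Num.min l (del / 3).
have h0 : 0 < h by rewrite lt_min l0 divr_gt0.
have hl : h <= l by rewrite ge_min lexx.
have hdel : h <= del / 3 by rewrite ge_min lexx orbT.
pose q' := q + h *: u; exists q'.
have q'q : enorm (q' - q) = h.
  by rewrite /q' (addrC q) addrK enormZ nu mulr1 ger0_norm // ltW.
rewrite q'q; split => //.
set s := P q'.
have sclose : enorm (P q - s) < (1 - c) * d q.
  apply: Pdel; first exact: MP.
  have := dist_lipschitz q' q; have := enorm_tri q q' s.
  rewrite (enormB q q') q'q /d -/s; lra.
have dqs : d q <= enorm (q - s) by apply: Pmin; exact: MP.
have us : c * d q <= dot u (q - s).
  have -> : q - s = d q *: u + (P q - s).
    by rewrite /u scalerA mulfV ?gt_eqF // scale1r subrKA.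
  rewrite dotDr dotZr dotuu nu.
  have := dot_le (- u) (P q - s); rewrite enormN nu dotNl; lra.
have e2 : d q' ^+ 2 = h ^+ 2 + 2 * (h * dot u (q - s)) + enorm (q - s) ^+ 2.
  rewrite /d -/s /q' (_ : q + h *: u - s = h *: u + (q - s)); last first.
    by rewrite addrA [h *: u + q]addrC.
  move: (q - s) => w.
  by rewrite sqr_enormD enormZ nu mulr1 ger0_norm ?(ltW h0) // dotZl.
have dq'0 : 0 <= d q' := enorm_ge0 _.
rewrite -(@ler_pXn2r _ 2) ?nnegrE //; last by rewrite addr_ge0 ?mulr_ge0 // ltW.
rewrite e2.
have : h * (c * d q) <= h * dot u (q - s) by rewrite ler_pM2l.
have : d q ^+ 2 <= enorm (q - s) ^+ 2 by rewrite lerXn2r ?nnegrE // enorm_ge0.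
have : c ^+ 2 * h ^+ 2 <= h ^+ 2 by rewrite ler_piMl ?sqr_ge0 // expr_le1 // ltW.
have := dq0; nra.
Qed.

(** For each slope [c < 1], a maximiser of [d] among the points of the ball that
satisfy [d p + c |q - p| <= d q] must lie on the bounding sphere, since otherwise
[dist_ascent] would lead to a higher such point.  Letting [c] tend to [1] bounds
the maximum of [d] over the whole ball. *)
Lemma dist_max p (l : R) : 0 < d p -> 0 < l -> d p + l < r ->
  exists2 q, enorm (q - p) <= l & d p + l <= d q.
Proof.
move=> dp0 l0 dplr.
have cp : continuous (fun q => enorm (q - p)).
  rewrite (_ : (fun q => _) = fun q => enorm (p - q)); last first.
    by apply/funext => q; rewrite enormB.
  exact: enormBl_continuous.
pose B := [set q | enorm (q - p) <= l].
have Bp : B p by rewrite /B /= subrr enorm0 ltW.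
have clB : closed B.
  apply: (@closed_comp _ _ _ [set x : R | x <= l]); last exact: closed_le.
  by move=> x _; exact: cp.
have bB : compact B.
  apply: bounded_closed_compact => //.
  exists (l + enorm p); split; first exact: num_real.
  move=> x lx q Bq; apply: le_trans (norm_le_enorm _) (ltW (le_lt_trans _ lx)).
  by have := enorm_tri q p 0; rewrite !subr0 => /le_trans; apply; rewrite lerD2r.
have [|qm qmB qmax] := compact_EVT_max (ex_intro _ _ Bp) bB (f := d).
  by apply: continuous_subspaceT; exact: dist_continuous.
exists qm; first exact: set_mem qmB.
(* Were [d qm < d p + l], the slope [c] below would contradict [H]; the maximum
   with [2^-1] keeps it positive. *)
suff H c : 0 < c < 1 -> d p + c * l <= d qm.
  rewrite leNgt; apply/negP => lt.
  pose c := Num.max (2^-1) (1 - (d p + l - d qm) / (2 * l)).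
  have c01 : 0 < c < 1.
    rewrite lt_max gt_max; apply/andP; split; first by rewrite invr_gt0 ltr0n.
    rewrite invf_lt1 ?ltr1n //= ltrBlDr ltrDl divr_gt0 ?mulr_gt0 //; lra.
  have := H _ c01.
  have : 1 - (d p + l - d qm) / (2 * l) <= c by rewrite le_max lexx orbT.
  rewrite lerBlDl -lerBlDr -(ler_pM2r l0) => h1 h2.
  have e : (d p + l - d qm) / (2 * l) * l = (d p + l - d qm) / 2.
    by field; rewrite gt_eqF.
  have := h1; rewrite mulrBl mul1r; nra.
move=> c01; have [c0 c1] := andP c01.
pose K := B `&` [set q | 0 <= d q - d p - c * enorm (q - p)].
have cK : compact K.
  apply: compact_closedI => //.
  apply: (@closed_comp _ _ _ [set x : R | 0 <= x]); last exact: closed_ge.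
  move=> x _; apply: (@continuousB _ _ _ (fun q => d q - d p)
    (fun q => c * enorm (q - p))).
    apply: (@continuousB _ _ _ d (cst (d p))); first exact: dist_continuous.
    exact: cst_continuous.
  apply: (@continuousM _ _ (cst c) (fun q => enorm (q - p))); last exact: cp.
  exact: cst_continuous.
have Kp : K p by split => //=; rewrite subrr subrr enorm0 mulr0 subr0.
have [|q /set_mem[Bq /= Kq] qKmax] := compact_EVT_max (ex_intro _ _ Kp) cK (f := d).
  by apply: continuous_subspaceT; exact: dist_continuous.
apply: le_trans (qmax q (mem_set Bq)).
have [ql|ql] := ltP (enorm (q - p)) l; last first.
  have : c * l <= c * enorm (q - p) by rewrite ler_pM2l.
  by move: Kq; lra.
have dpq : d p <= d q.
  have : 0 <= c * enorm (q - p) by rewrite mulr_ge0 ?enorm_ge0 // ltW.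
  by move: Kq; lra.
have dqr : 0 < d q < r.
  apply/andP; split; first lra.
  have := dist_lipschitz q p; lra.
have [|q' [qq'0 qq'l qq'd]] := dist_ascent dqr c01 (l := l - enorm (q - p)).
  by rewrite subr_gt0.
have cqq' : 0 < c * enorm (q' - q) by rewrite mulr_gt0.
have tri := enorm_tri q' q p.
have ctri : c * enorm (q' - p) <= c * (enorm (q' - q) + enorm (q - p)).
  by rewrite ler_pM2l.
have : K q'.
  split; rewrite /B /=; first lra.
  by move: Kq ctri; rewrite mulrDr; lra.
move=> /mem_set /qKmax; lra.
Qed.

(** The point [q] of [dist_max] satisfies
[rho <= |q - P p| <= |q - p| + |p - P p| <= rho]; equality forces it onto the ray
from [P p] through [p].  Thus the centre of the tangent ball is at distance
[rho] from [M]. *)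
Lemma le_tangent_ball_dist p b (rho : R) : M b -> 0 < d p < rho -> rho < r ->
  rho <= enorm (P p + (rho / d p) *: (p - P p) - b).
Proof.
move=> Mb /andP[dp0 dprho] rhor.
have [||q ql qd] := @dist_max p (rho - d p) dp0; [lra|lra|].
suff <- : q = P p + (rho / d p) *: (p - P p).
  by apply: le_trans (Pmin q Mb); move: qd; rewrite -/(d q); lra.
set l := rho - d p in ql qd *.
pose u := (d p)^-1 *: (p - P p).
have nu : enorm u = 1.
  by rewrite /u enormZ ger0_norm ?invr_ge0 ?(ltW dp0) // mulVf // gt_eqF.
have pu : p - P p = d p *: u by rewrite scalerA mulfV ?gt_eqF // scale1r.
rewrite {1}pu scalerA divfK ?gt_eqF //.
suff w0 : q - p - l *: u = 0.
  apply/eqP; rewrite -subr_eq0 -w0 /l scalerBl -pu; apply/eqP.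
  by apply/rowP => i; rewrite !mxE; ring.
apply: enorm0_eq0; apply/eqP; rewrite -sqrf_eq0 eq_le sqr_ge0 andbT.
have qP : d p + l <= enorm (q - P p) by apply: le_trans qd _; exact: Pmin.
have : (d p + l) ^+ 2 <= enorm (q - P p) ^+ 2.
  by rewrite lerXn2r ?nnegrE ?enorm_ge0 // /l; lra.
have l0 : 0 <= l by rewrite /l; lra.
rewrite -{1}(subrKA p) pu; clearbody l.
move: (u) (q - p) nu ql => {pu qP}u w nu ql.
rewrite !sqr_enormD !enormN !enormZ nu dotNr !dotZr.
rewrite !mulr1 !real_normK ?num_real //.
have := enorm_ge0 w; set e := enorm w in ql *; set k := dot _ _ => e0 h.
have : e ^+ 2 <= l ^+ 2 by rewrite lerXn2r ?nnegrE //; lra.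
move: h; nra.
Qed.

(** Expansion of [rho^2 <= |rho u - (b - P p)|^2], where [u] is the unit vector
from [P p] to [p]. *)
Lemma federer_inequality p b (rho : R) : M b -> 0 < rho < r -> d p < rho ->
  dot (p - P p) (b - P p) <= d p / (2 * rho) * enorm (b - P p) ^+ 2.
Proof.
move=> Mb /andP[rho0 rhor] dprho.
have [dp0|dp0] := eqVneq (d p) 0.
  by rewrite (enorm0_eq0 dp0) dp0 mul0r mul0r /dot big1 // => i _; rewrite mxE mul0r.
have {}dp0 : 0 < d p by rewrite lt_def dp0 enorm_ge0.
have := @le_tangent_ball_dist p b rho Mb; rewrite dp0 dprho => /(_ isT rhor) h.
have : rho ^+ 2 <= enorm (P p + (rho / d p) *: (p - P p) - b) ^+ 2.
  by rewrite lerXn2r ?nnegrE ?enorm_ge0 // ltW.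
rewrite (_ : P p + _ - b = (rho / d p) *: (p - P p) + - (b - P p)); last first.
  by apply/rowP => i; rewrite !mxE; ring.
move: (b - P p) => v.
rewrite sqr_enormD enormZ enormN dotNr dotZl -/(d p) ger0_norm; last first.
  by rewrite divr_ge0 // ltW.
rewrite divfK ?gt_eqF //.
set k := dot _ _; set e := enorm _ => h2.
have h3 : rho / d p * k * 2 <= e ^+ 2 by lra.
have := ler_wpM2l (ltW (divr_gt0 dp0 (mulr_gt0 (ltr0Sn R 1) rho0))) h3.
apply: le_trans; rewrite le_eqVlt; apply/orP; left; apply/eqP.
by field; rewrite !gt_eqF.
Qed.

(** Federer's inequality at [p] and at [q], added up, reads
[|P p - P q|^2 - <p - q, P p - P q> <= (s / rho) |P p - P q|^2]; Cauchy-Schwarz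
concludes. *)
Lemma projection_lipschitz p q (rho s : R) :
  0 < rho < r -> d p <= s -> d q <= s -> s < rho ->
  (1 - s / rho) * enorm (P p - P q) <= enorm (p - q).
Proof.
move=> rho01 dps dqs srho.
have [rho0 _] := andP rho01.
have h1 := @federer_inequality p (P q) rho (MP q) rho01 (le_lt_trans dps srho).
have h2 := @federer_inequality q (P p) rho (MP p) rho01 (le_lt_trans dqs srho).
have [e0|e0] := eqVneq (enorm (P p - P q)) 0; first by rewrite e0 mulr0 enorm_ge0.
have {}e0 : 0 < enorm (P p - P q) by rewrite lt_def e0 enorm_ge0.
rewrite -(ler_pM2r e0).
have h3 := dot_le (p - q) (P p - P q).
apply: le_trans h3; rewrite -mulrA -expr2.
rewrite enormB in h1.
set e := enorm (P p - P q) in h1 h2 e0 *.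
have -> : dot (p - q) (P p - P q) =
   e ^+ 2 - dot (p - P p) (P q - P p) - dot (q - P q) (P p - P q).
  by rewrite /e -dotuu !(dotDl, dotDr, dotNl, dotNr); ring.
have k t : d t <= s -> d t / (2 * rho) * e ^+ 2 <= s / rho / 2 * e ^+ 2.
  move=> ts; rewrite (_ : s / rho / 2 = s / (2 * rho)); last by field; rewrite gt_eqF.
  by rewrite ler_wpM2r ?sqr_ge0 // ler_wpM2r ?invr_ge0 ?mulr_ge0 // ltW.
have := k p dps; have := k q dqs; lra.
Qed.
End Projection.

(** * Strict differentiability of C^1 maps *)

Section Line.
Context {R : realType} {V W : normedModType R}.
Implicit Types (f : V -> W) (a w : V) (t : R).

Local Instance is_diff_line a w t :
  is_diff t (fun t : R => a + t *: w) (fun t : R => t *: w).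
Proof.
apply: (@is_diff_eq _ _ _ _ (0 + (fun t : R => t *: w))); last by rewrite add0r.
Qed.

Lemma is_diff_on_line f a w t : differentiable f (a + t *: w) ->
  is_diff t (fun t : R => f (a + t *: w)) (fun s => 'd f (a + t *: w) (s *: w)).
Proof.
move=> df.
have fd : is_diff (a + t *: w) f ('d f (a + t *: w)) by split.
exact: (@is_diff_comp _ _ _ _ (fun t : R => a + t *: w) _ f _ t
  (is_diff_line a w t) fd).
Qed.

Lemma derive_on_line f a w t v : differentiable f (a + t *: w) ->
  'D_v (fun t : R => f (a + t *: w)) t = 'D_(v *: w) f (a + t *: w).
Proof.
move=> df; have [dc vc] := is_diff_on_line df.
by rewrite deriveE // deriveE // vc.
Qed.

Lemma open_line (U : set V) a w : open U -> open [set t : R | U (a + t *: w)].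
Proof.
move=> oU; apply: (@open_comp _ _ (fun t : R => a + t *: w) U) => // t _.
by apply: differentiable_continuous; case: (is_diff_line a w t).
Qed.

Lemma near_line (U : set V) a w t : open U -> U (a + t *: w) ->
  \forall s \near t, U (a + s *: w).
Proof. by move=> oU Ut; apply: open_nbhs_nbhs; split; [exact: open_line|]. Qed.

(** The induction on [k] needs [h] to agree with [f] on the line only over [U]:
the derivative of [h] is identified with a directional derivative of [f] there
and nowhere else.  The differential calculus in one real variable transfers
between functions that agree near a point. *)
Lemma class_on_line k (U : set V) f a w (h : R^o -> W) : open U ->
  (forall t, U (a + t *: w) -> h t = f (a + t *: w)) ->
  class_on k U f -> class_on k ([set t | U (a + t *: w)] : set R^o) h.
Proof.
move=> oU; elim: k f h => [|k IH] f h hf.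
  move=> cf t /= Ut.
  rewrite /prop_for /continuous_at hf //.
  have nt : \forall s \near t, f (a + s *: w) = h s.
    by apply: filterS (near_line oU Ut) => s /hf.
  apply: cvg_trans (near_eq_cvg nt) _.
  apply: (@continuous_comp _ _ _ (fun t : R => a + t *: w) f t); last exact: cf.
  by apply: differentiable_continuous; case: (is_diff_line a w t).
move=> [df cf].
have nt t : U (a + t *: w) -> \forall s \near t, f (a + s *: w) = h s.
  by move=> Ut; apply: filterS (near_line oU Ut) => s /hf.
split.
  move=> t /= Ut; apply/derivable1_diffP; apply: near_eq_derivable (nt t Ut) _.
  by apply: diff_derivable; case: (is_diff_on_line (df _ Ut)).
move=> v; apply: (IH ('D_(v *: w) f)); last exact: cf.
move=> t Ut; rewrite -derive_on_line; last exact: df.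
by apply/esym/near_eq_derive/nt.
Qed.

End Line.

(** The mean value theorem applied to each coordinate; the sup norm makes the
constant survive. *)
Lemma mean_value_norm (R : realType) (m : nat) (F : R -> 'rV[R]_m) (C : R) :
  (forall t : R, 0 <= t <= 1 -> differentiable F t) ->
  (forall t : R, 0 <= t <= 1 -> `|'D_1 F t| <= C) -> `|F 1 - F 0| <= C.
Proof.
move=> dF FC.
have C0 : 0 <= C.
  by apply: le_trans (FC 0 _) => //; rewrite lexx ler01.
rewrite /Num.Def.normr /= mx_normrE; apply: bigmax_le => // -[i j] _ /=.
rewrite (ord1 i) !mxE.
have dj t : 0 <= t <= 1 -> derivable (fun s => F s ord0 j) t 1.
  by move=> t01; have /derivable_mxP := @diff_derivable _ _ _ F t 1 (dF t t01); exact.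
have [|||c c01 ->] := @MVT_segment R (fun t => F t ord0 j)
  (fun t => 'D_1 F t ord0 j) 0 1.
- exact: ler01.
- rewrite /= => t t01; have t01' : 0 <= t <= 1 by rewrite !ltW ?(itvP t01).
  split; first exact: dj.
  by rewrite derive_mx ?mxE //; apply: diff_derivable; exact: dF.
- apply: derivable_within_continuous => t t01; by apply: dj; rewrite !(itvP t01).
by rewrite subr0 mulr1 (le_trans (coord_le_norm _ _)) // FC // !(itvP c01).
Qed.

Lemma linear_sum_delta (R : realType) (n : nat) (W : normedModType R)
   (L : {linear 'rV[R]_n -> W}) w :
  L w = \sum_(j < n) w ord0 j *: L (delta_mx ord0 j).
Proof.
by rewrite {1}(row_sum_delta w) linear_sum; apply: eq_bigr => j _; rewrite linearZ.
Qed.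

Lemma linear_dist_le_basis (R : realType) (n m : nat)
    (L1 L2 : {linear 'rV[R]_n -> 'rV[R]_m}) (e : R) w :
  (forall j, `|L1 (delta_mx ord0 j) - L2 (delta_mx ord0 j)| <= e) ->
  `|L2 w - L1 w| <= n%:R * e * `|w|.
Proof.
move=> Le; rewrite distrC.
have -> : L1 w - L2 w =
    \sum_(j < n) w ord0 j *: (L1 (delta_mx ord0 j) - L2 (delta_mx ord0 j)).
  rewrite (linear_sum_delta L1) (linear_sum_delta L2) -sumrB.
  by apply: eq_bigr => j _; rewrite scalerBr.
apply: (@le_trans _ _ (\sum_(j < n) e * `|w|)).
  apply: le_trans (ler_norm_sum _ _ _) _; apply: ler_sum => j _.
  by rewrite normrZ mulrC ler_pM // coord_le_norm.
by rewrite sumr_const card_ord -[leLHS]mulr_natl mulrA.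
Qed.

Lemma ball_convex (R : realType) (V : normedModType R) (c p q : V) (del t : R) :
  ball c del p -> ball c del q -> 0 <= t <= 1 -> ball c del (p + t *: (q - p)).
Proof.
rewrite -!ball_normE /= => cp cq /andP[t0 t1].
have -> : c - (p + t *: (q - p)) = (1 - t) *: (c - p) + t *: (c - q).
  rewrite scalerBl scale1r -addrA [- _ + _]addrC -scalerBr !opprB.
  by rewrite [c - q + _]addrC subrKA -[p - q]opprB scalerN opprD addrA.
apply: le_lt_trans (ler_normD _ _) _; rewrite !normrZ.
rewrite (ger0_norm t0) ger0_norm ?subr_ge0 //.
have [t00|t00] := eqVneq t 0; first by rewrite t00 subr0 mul1r mul0r addr0.
have {}t0 : 0 < t by rewrite lt_def t00.
have : t * `|c - q| < t * del by rewrite ltr_pM2l.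
have : (1 - t) * `|c - p| <= (1 - t) * del by rewrite ler_wpM2l ?subr_ge0 // ltW.
lra.
Qed.

(** The directional derivatives along the basis vectors are continuous, so the
differential of [f - L], where [L] is the differential of [f] at [p0], is small
near [p0]; the mean value inequality along [[p, q]] gives the estimate. *)
Lemma strict_differentiability (R : realType) (n m : nat) (U : set 'rV[R]_n)
    (f : 'rV[R]_n -> 'rV[R]_m) (p0 : 'rV[R]_n) :
  open U -> U p0 -> class_on 1 U f ->
  exists2 L : {linear 'rV[R]_n -> 'rV[R]_m}, continuous L &
  forall eta : R, 0 < eta ->
  exists2 del : R, 0 < del & forall p q, ball p0 del p -> ball p0 del q ->
    U p /\ `|f q - f p - L (q - p)| <= eta * `|q - p|.
Proof.
move=> oU Up0 [df cf]; exists ('d f p0); first exact/diff_continuous/df.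
move=> eta eta0.
have np : 0 < n%:R + 1 :> R by rewrite ltr_wpDl.
pose eta' := eta / (n%:R + 1).
have eta'0 : 0 < eta' by rewrite divr_gt0.
have : \forall z \near p0, U z /\ forall j : 'I_n,
    `|'D_(delta_mx ord0 j) f p0 - 'D_(delta_mx ord0 j) f z| <= eta'.
  have near_j : \forall z \near p0, forall j : 'I_n,
      `|'D_(delta_mx ord0 j) f p0 - 'D_(delta_mx ord0 j) f z| <= eta'.
    apply: (@filter_forall _ _ (fun j z => _ <= eta')
      (nbhs p0) (nbhs_filter p0)) => j.
    have := cf (delta_mx ord0 j) p0 Up0.
    by move/(@cvgrPdist_le _ _ _ (nbhs p0) (nbhs_filter p0)); apply.
  by apply: filterS2 near_j (open_nbhs_nbhs (conj oU Up0)) => z.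
move=> /nbhs_ballP[del /= del0 Bdel]; exists del => // p q Bp Bq.
split; first by have [] := Bdel p Bp.
pose L : {linear 'rV[R]_n -> 'rV[R]_m} := 'd f p0.
pose F (t : R) : 'rV[R]_m := f (p + t *: (q - p)) - t *: L (q - p).
have Bt (t : R) : 0 <= t <= 1 -> ball p0 del (p + t *: (q - p)).
  exact: ball_convex.
have dt (t : R) : 0 <= t <= 1 ->
    is_diff t F (fun s => 'd f (p + t *: (q - p)) (s *: (q - p)) - s *: L (q - p)).
  move=> /Bt /Bdel[Ut _]; rewrite /F.
  have := is_diff_on_line (df _ Ut) => d1.
  have d2 : is_diff t (fun t : R => t *: L (q - p)) (fun t : R => t *: L (q - p)).
    exact: is_diff_scalel.
  exact: (is_diffB d1 d2).
have -> : f q - f p - L (q - p) = F 1 - F 0.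
  by rewrite /F !scale1r !scale0r addr0 subr0 (addrC p) subrK addrAC.
apply: mean_value_norm; first by move=> t /dt [].
move=> t t01; have [dF vF] := dt t t01.
rewrite deriveE // vF !scale1r.
have [Ut Dt] := Bdel _ (Bt _ t01).
move: (p + t *: (q - p)) Ut Dt => z Uz Dz; move: (q - p) => w.
have := @linear_dist_le_basis R n m ('d f p0) ('d f z) eta' w.
move=> /(_ _)/le_trans; apply.
  by move=> j; have := Dz j; rewrite (deriveE _ (df z Uz)) (deriveE _ (df p0 Up0)).
rewrite ler_wpM2r // /eta' mulrCA.
by rewrite ler_piMr ?(ltW eta0) // ler_pdivrMr // mul1r lerDl.
Qed.

(** * Short smooth arcs in a compact submanifold *)

(** Arcs are parametrised by [[0, 1]] whatever their length, so that arcs with a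
common constant [K] concatenate to a [K]-Lipschitz curve. *)
Definition smooth_arc (R : realType) (N : nat) (M : set 'rV[R]_N) (K : R)
    (p q : 'rV[R]_N) : Prop :=
  exists g : R -> 'rV[R]_N,
    [/\ g 0 = p, g 1 = q, smooth_on_itv 0 1 g,
        forall t, 0 <= t <= 1 -> M (g t) &
        forall s t, 0 <= s <= 1 -> 0 <= t <= 1 ->
          enorm (g s - g t) <= K * `|s - t|].

(** In a chart [phi] with inverse [psi], take [g t = psi (phi p + t w)] with
[w = phi q - phi p].  Strict differentiability of [psi] makes
[g s - g t - (s - t) (q - p)] small compared with [|s - t| |w|], and that of
[phi] bounds [|w|] by a multiple of [|p - q|]. *)
Lemma local_arc (R : realType) (N m : nat) (M : set 'rV[R]_N) (p0 : 'rV[R]_N) :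
  embedded_submanifold m M -> M p0 ->
  exists2 del : R, 0 < del & forall p q, M p -> M q ->
    ball p0 del p -> ball p0 del q -> smooth_arc M (3 / 2 * enorm (p - q)) p q.
Proof.
move=> [_ chart] Mp0.
have [U [V [phi [psi [[oU Up0 oV] [sphi spsi phiK psiK imM]]]]]] := chart p0 Mp0.
have [Vp0 _] := phiK p0 Up0.
have [L cL strict1] := strict_differentiability oU Up0 (sphi 1%N).
have {strict1}[d1 d10 strict1] := strict1 1 ltr01.
have [C C0 LC] := linear_lipschitz cL.
have [L' _ strict2] := strict_differentiability oV Vp0 (spsi 1%N).
have N1 : 0 < N%:R + 1 :> R by rewrite ltr_wpDl.
have C1 : 0 < C + 1 by lra.
(* [eta] absorbs the factor [C + 1] from [|w|], the factor [N] from comparing the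
   norms, and a factor [2] from the two uses of strict differentiability, leaving
   [1/2 |p - q|]. *)
pose eta : R := (4 * (N%:R + 1) * (C + 1))^-1.
have eta0 : 0 < eta by rewrite invr_gt0 !mulr_gt0.
have [d2 d20 {}strict2] := strict2 eta eta0.
have /nbhs_ballP[d3 /= d30 cphi] : \forall p \near p0, ball (phi p0) d2 (phi p).
  have := sphi 0%N p0 Up0; apply; exact: nbhsx_ballx.
exists (Num.min d1 d3); first by rewrite lt_min d10.
move=> p q Mp Mq Bp Bq.
have B1 z : ball p0 (Num.min d1 d3) z -> ball p0 d1 z.
  by apply: le_ball; rewrite ge_min lexx.
have B3 z : ball p0 (Num.min d1 d3) z -> ball (phi p0) d2 (phi z).
  move=> Bz; apply: cphi; apply: le_ball Bz; by rewrite ge_min lexx orbT.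
have [Up phipq] := strict1 p q (B1 _ Bp) (B1 _ Bq).
have [Uq _] := strict1 q p (B1 _ Bq) (B1 _ Bp).
have sl z : M z -> U z -> slice m (phi z).
  move=> Mz Uz; suff : (V `&` slice m) (phi z) by case.
  by rewrite -imM; exists z.
set w := phi q - phi p.
have wpq : `|w| <= (C + 1) * `|p - q|.
  have := ler_normD (w - L (q - p)) (L (q - p)); rewrite subrK.
  move=> /le_trans; apply; rewrite (distrC p q) mulrDl addrC.
  by apply: lerD; [exact: LC|exact: phipq].
pose A t := phi p + t *: w.
have A0 : A 0 = phi p by rewrite /A scale0r addr0.
have A1 : A 1 = phi q by rewrite /A scale1r /w addrC subrK.
have AB t : 0 <= t <= 1 -> ball (phi p0) d2 (A t).
  by apply: ball_convex; exact: B3.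
have AV t : 0 <= t <= 1 -> V (A t).
  by move=> /AB At; have [] := strict2 _ _ At At.
have AAw s t : A s - A t = (s - t) *: w.
  by rewrite /A opprD addrACA subrr add0r scalerBl.
exists (psi \o A); split.
- by rewrite /= A0; case: (phiK p Up).
- by rewrite /= A1; case: (phiK q Uq).
- exists [set t | V (A t)], (psi \o A); split => //.
  + exact: open_line.
  + by move=> k; apply: (class_on_line oV _ (spsi k)).
- move=> t t01.
  have : (V `&` slice m) (A t).
    split; first exact: AV.
    move=> i mi; rewrite !mxE (sl p Mp Up i mi) (sl q Mq Uq i mi).
    by rewrite subrr mulr0 addr0.
  by rewrite -imM => -[z [Mz Uz] e]; rewrite /= -e; have [_ ->] := phiK z Uz.
- move=> s t s01 t01 /=.
  have [_ h1] := strict2 _ _ (AB t t01) (AB s s01).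
  have [_ h2] := strict2 _ _ (B3 _ Bp) (B3 _ Bq).
  have [[_ ep] [_ eq]] := (phiK p Up, phiK q Uq).
  rewrite ep eq -/w in h2; rewrite AAw linearZ /= normrZ in h1.
  set e := `|s - t| in h1 *; have e0 : 0 <= e by exact: normr_ge0.
  set D := psi (A s) - psi (A t) in h1 *.
  have -> : D = (s - t) *: (q - p) +
      ((D - (s - t) *: L' w) - (s - t) *: (q - p - L' w)).
    by rewrite [(s - t) *: (q - p - _)]scalerBr opprB subrKA [RHS]addrC subrK.
  apply: le_trans (enormD _ _) _; rewrite enormZ -/e (enormB q p).
  have Np := norm_le_enorm (p - q); set P := enorm (p - q) in Np *.
  suff : enorm (D - (s - t) *: L' w - (s - t) *: (q - p - L' w)) <=
      2^-1 * P * e by lra.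
  apply: le_trans (enorm_le_norm _) _.
  have h3 : `|D - (s - t) *: L' w - (s - t) *: (q - p - L' w)| <=
      2 * eta * e * `|w|.
    apply: le_trans (ler_normB _ _) _; rewrite normrZ -/e.
    have := ler_wpM2l e0 h2; lra.
  have h4 : `|w| <= (C + 1) * P by apply: le_trans wpq _; rewrite ler_pM2l.
  have NN : 0 <= N%:R :> R by [].
  apply: (@le_trans _ _ ((N%:R + 1) * (2 * eta * e * ((C + 1) * P)))).
    apply: ler_pM => //; first by rewrite lerDl.
    by apply: le_trans h3 _; rewrite ler_wpM2l // !mulr_ge0 // ltW.
  rewrite le_eqVlt; apply/orP; left; apply/eqP; rewrite /eta.
  by field; rewrite !gt_eqF.
Qed.

Lemma uniform_arc (R : realType) (N m : nat) (M : set 'rV[R]_N) :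
  closed_submanifold m M ->
  exists2 del : R, 0 < del & forall p q, M p -> M q ->
    enorm (p - q) < del -> smooth_arc M (3 / 2 * enorm (p - q)) p q.
Proof.
move=> [cM subM].
pose Q (del : R) p := M p -> forall q, M q -> enorm (p - q) < del ->
  smooth_arc M (3 / 2 * enorm (p - q)) p q.
have [|] := (compact_near_coveringP M).1 cM R (0^'+) Q _.
  move=> p0 Mp0.
  have [del del0 H] := local_arc subM Mp0.
  exists (ball p0 (del / 2), [set e : R | e < del / 2]).
    split; first by apply: nbhsx_ballx; rewrite divr_gt0.
    by apply: nbhs_right_lt; rewrite divr_gt0.
  move=> [p e] /= [Bp ed] Mp q Mq pq.
  apply: H => //; first by apply: le_ball Bp; lra.
  move: Bp; rewrite -!ball_normE /= => Bp.
  have := ler_normD (p0 - p) (p - q); rewrite subrKA.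
  have := norm_le_enorm (p - q); lra.
move=> e /= e0 He.
exists (e / 2); first by rewrite divr_gt0.
move=> p q Mp Mq pq; apply: (He (e / 2)) => //=.
- by rewrite sub0r normrN gtr0_norm; lra.
- lra.
Qed.

(** * Concatenation of arcs and the geodesic distance *)

Lemma smooth_on_itv_shift (R : realType) (N : nat) (a b c : R)
    (g h : R -> 'rV[R]_N) :
  smooth_on_itv a b g -> (forall t, a + c <= t <= b + c -> h t = g (t - c)) ->
  smooth_on_itv (a + c) (b + c) h.
Proof.
move=> [X [k [oO abO sk gk]]] hg.
have shift t : - c + t *: (1 : R^o) = t - c by rewrite addrC [_ *: _]mulr1.
exists [set t : R | X (- c + t *: (1 : R^o))], (fun t => k (t - c)); split.
- exact: (@open_line _ R^o X).
- move=> t; rewrite /= in_itv /= shift => /andP[at_ tb].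
  by apply: abO; rewrite /= in_itv /= lerBrDr at_ lerBlDr.
- move=> n; apply: (class_on_line oO _ (sk n)) => t _; by rewrite shift.
- move=> t; rewrite in_itv /= => tab; rewrite hg // gk // in_itv /=.
  by rewrite lerBrDr lerBlDr.
Qed.

Lemma smooth_on_itv_eq (R : realType) (N : nat) (a b : R)
    (g h : R -> 'rV[R]_N) :
  (forall t, a <= t <= b -> h t = g t) -> smooth_on_itv a b g -> smooth_on_itv a b h.
Proof.
move=> hg [X [k [oO abO sk gk]]]; exists X, k; split => // t tab.
by rewrite hg ?gk // -in_itv.
Qed.

(** The curve is defined and Lipschitz on the whole line, constant after [n], so
that two-sided difference quotients are controlled at the endpoints too. *)
Lemma concat_arcs (R : realType) (N : nat) (M : set 'rV[R]_N) (K : R)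
    (z : nat -> 'rV[R]_N) (n : nat) : 0 <= K -> M (z 0%N) ->
  (forall i, (i < n)%N -> smooth_arc M K (z i) (z i.+1)) ->
  exists g : R -> 'rV[R]_N,
    [/\ piecewise_smooth 0 n%:R g, g 0 = z 0%N,
        forall t, n%:R <= t -> g t = z n,
        forall t, M (g t) &
        forall s t, enorm (g s - g t) <= K * `|s - t|].
Proof.
move=> K0 Mz0; elim: n => [_|n IH arcs].
  exists (fun=> z 0%N); split => //.
    by exists [::]; split => //; split => //=.
  by move=> s t; rewrite subrr enorm0 mulr_ge0.
have [|g [[sq [[psq /eqP lsq] smsq] g0 gn Mg gK]]] := IH _.
  by move=> i /ltnW; exact: arcs.
have [k [k0 k1 smk Mk kK]] := arcs n (leqnn _).
(* Clamping the parameter keeps the curve constant after [n.+1]. *)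
pose c (t : R) := Num.min (t - n%:R) 1.
pose h (t : R) := if t <= n%:R then g t else k (c t).
have c01 t : n%:R <= t -> 0 <= c t <= 1.
  by move=> nt; rewrite /c le_min subr_ge0 nt ler01 ge_min lexx orbT.
have hn t : n%:R <= t -> h t = k (c t).
  rewrite /h; case: (ltrgtP t n%:R) => // -> _.
  by rewrite gn // /c subrr min_l // k0.
have hg t : t <= n%:R -> h t = g t by rewrite /h => ->.
have hK s t : s <= t -> enorm (h s - h t) <= K * `|s - t|.
  move=> st.
  have cc u v : n%:R <= u -> u <= v -> enorm (h u - h v) <= K * `|u - v|.
    move=> nu uv; rewrite !hn //; last exact: le_trans uv.
    apply: le_trans (kK _ _ (c01 _ nu) (c01 _ (le_trans nu uv))) _.
    rewrite ler_wpM2l // distrC [leRHS]distrC !ger0_norm ?subr_ge0 //.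
      by rewrite /c; case: (lerP (u - n%:R) 1); case: (lerP (v - n%:R) 1); lra.
    by rewrite le_min !ge_min lexx orbT lerD2r uv.
  have [tn|/ltW tn] := leP t n%:R.
    by rewrite !hg // (le_trans st).
  have [ns|/ltW ns] := leP n%:R s; first exact: cc.
  apply: le_trans (enorm_tri _ (h n%:R) _) _.
  have -> : `|s - t| = `|s - n%:R| + `|n%:R - t|.
    by rewrite !ler0_norm ?subr_le0 //; lra.
  rewrite mulrDr lerD //; last exact: cc.
  by rewrite !hg.
exists h; split.
- exists (rcons sq n.+1%:R); split.
    split; last by rewrite last_rcons.
    by rewrite rcons_path psq lsq ltr_nat /=.
  move=> i; rewrite size_rcons ltnS leq_eqVlt => /orP[/eqP ->|isz].
    rewrite [X in smooth_on_itv _ X](_ : _ = 1 + n%:R); last first.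
      by rewrite nth_rcons ltnn eqxx -natr1 addrC.
    rewrite [X in smooth_on_itv X](_ : _ = 0 + n%:R); last first.
      by rewrite -rcons_cons nth_rcons /= ltnSn add0r -lsq (last_nth n.+1%:R).
    apply: smooth_on_itv_shift smk _ => t /andP[t0 t1].
    by rewrite hn /c ?min_l //; lra.
  rewrite -rcons_cons !nth_rcons isz /= ltnS (ltnW isz).
  rewrite (set_nth_default n%:R) /= ?ltnS ?(ltnW isz) //.
  rewrite [X in smooth_on_itv _ X](set_nth_default n%:R) //.
  apply: smooth_on_itv_eq (smsq i isz) => t /andP[_ ti]; apply: hg.
  apply: le_trans ti _.
  have := @itv_partition_nth_le _ _ 0 n%:R sq i.+1; rewrite ltnS /=; apply => //.
  by split => //; rewrite lsq.
- by rewrite hg.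
- move=> t nt; rewrite hn; last by apply: le_trans nt; rewrite ler_nat.
  by rewrite /c min_r ?k1 // lerBrDr addrC natr1.
- move=> t; rewrite /h; case: leP => [_|/ltW nt]; first exact: Mg.
  by apply: Mk; exact: c01.
- move=> s t; have [st|/ltW ts] := leP s t; first exact: hK.
  by rewrite enormB distrC hK.
Qed.

Lemma geodesic_dist_le_chain (R : realType) (N : nat) (M : set 'rV[R]_N) (K : R)
    (z : nat -> 'rV[R]_N) (n : nat) : 0 <= K -> M (z 0%N) -> (0 < n)%N ->
  (forall i, (i < n)%N -> smooth_arc M K (z i) (z i.+1)) ->
  (geodesic_dist M (z 0%N) (z n) <= (K * n%:R)%:E)%E.
Proof.
move=> K0 Mz0 n0 arcs.
have [g [smg g0 gn Mg gK]] := concat_arcs K0 Mz0 arcs.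
apply: (@le_trans _ _ (curve_length 0 n%:R g)); last first.
  by apply: le_trans (curve_length_le _ gK) _; rewrite ?subr0.
apply: ereal_inf_lbound; exists 0, n%:R, g; split => //.
by split => //; [rewrite ltr0n|rewrite gn].
Qed.

Lemma nearest_exists (R : realType) (N : nat) (M : set 'rV[R]_N)
    (p : 'rV[R]_N) :
  compact M -> M !=set0 ->
  exists2 a, M a & forall s, M s -> enorm (p - a) <= enorm (p - s).
Proof.
move=> cM M0.
have [|a aM amin] := compact_EVT_min M0 cM
  (f := fun s : 'rV[R]_N => enorm (p - s)).
  by apply: continuous_subspaceT; exact: enormBl_continuous.
exists a; first exact: set_mem.
by move=> s Ms; apply: amin; exact: mem_set.
Qed.

Lemma dist_toE (R : realType) (N : nat) (M : set 'rV[R]_N) (p a : 'rV[R]_N) :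
  M a -> (forall s, M s -> enorm (p - a) <= enorm (p - s)) ->
  dist_to p M = (enorm (p - a))%:E.
Proof.
move=> Ma amin; apply/eqP; rewrite eq_le; apply/andP; split.
  by apply: ereal_inf_lbound; exists a => //; rewrite enormB.
by apply: le_ereal_inf_tmp => _ [s Ms <-]; rewrite lee_fin (enormB s) amin.
Qed.

Lemma lt_reach (R : realType) (N : nat) (M : set 'rV[R]_N) (e : R) :
  (e%:E < reach M)%E ->
  exists2 r, e < r & forall p, tube M r p -> exists! x, nearest M p x.
Proof.
by move=> /ereal_sup_gt[_ [r [_ rU] <-]]; rewrite lte_fin => er; exists r.
Qed.

Theorem corollary5p9 (R : realType) (N m : nat) (M : set 'rV[R]_N)
    (hM : closed_submanifold m M) (x y : 'rV[R]_N) (hx : M x) (hy : M y)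
    (hxy : ((enorm (x - y)%R)%:E < reach M * (2^-1)%R%:E)%E) :
  (geodesic_dist M x y <= (2 * enorm (x - y))%R%:E)%E.
Proof.
set D := enorm (x - y) in hxy *.
have D0 : 0 <= D := enorm_ge0 _.
have [cM _] := hM.
have [r Dr rU] : exists2 r, 2 * D < r &
    forall p, tube M r p -> exists! x, nearest M p x.
  apply: lt_reach; rewrite mulrC EFinM -lte_pdivlMr //.
have /choice[P PP] : forall p, exists a, M a /\
    forall s, M s -> enorm (p - a) <= enorm (p - s).
  by move=> p; have [a] := nearest_exists p cM (ex_intro _ x hx); exists a.
have MP p : M (P p) by have [] := PP p.
have Pmin p s : M s -> enorm (p - P p) <= enorm (p - s).
  by move=> Ms; have [_] := PP p; apply.
have PM p : M p -> P p = p.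
  move=> Mp; apply/esym/eqP; rewrite -subr_eq0; apply/eqP/enorm0_eq0/le_anti.
  by rewrite enorm_ge0 andbT; have := Pmin p p Mp; rewrite subrr enorm0.
have Puniq p : enorm (p - P p) < r ->
    forall s, M s -> enorm (p - s) = enorm (p - P p) -> s = P p.
  move=> pr s Ms sp; have dE := dist_toE (MP p) (Pmin p).
  have [|c [_ cu]] := rU p; first by rewrite /tube /= dE lte_fin.
  by rewrite -(cu s) ?(cu (P p)) //; split => //; rewrite dE ?sp.
have [del del0 arcM] := uniform_arc hM.
have [n n0 nD] : exists2 n, (0 < n)%N & 4 / 3 * (D / n%:R) < del.
  pose n := (Num.bound (del^-1 * (4 / 3 * D))).+1.
  exists n => //; have n0 : 0 < n%:R :> R by rewrite ltr0n.
  rewrite mulrA ltr_pdivrMr // -ltr_pdivrMl //.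
  have b0 : 0 <= del^-1 * (4 / 3 * D) by rewrite !mulr_ge0 ?invr_ge0 // ltW.
  by apply: lt_trans (archi_boundP b0) _; rewrite ltr_nat.
have n0R : 0 < n%:R :> R by rewrite ltr0n.
pose c (i : nat) := x + (i%:R / n%:R) *: (y - x).
have cD i j : enorm (c i - c j) = `|i%:R - j%:R| / n%:R * D.
  rewrite /c opprD addrACA subrr add0r -scalerBl -mulrBl enormZ normrM normfV.
  by rewrite (gtr0_norm n0R) enormB.
have c0 : c 0%N = x by rewrite /c mul0r scale0r addr0.
have cn : c n = y by rewrite /c divff ?gt_eqF // scale1r addrC subrK.
have dc i : (i <= n)%N -> enorm (c i - P (c i)) <= D / 2.
  have [Mc0 Mcn] : M (c 0%N) /\ M (c n) by rewrite c0 cn.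
  move=> lin; have := Pmin (c i) _ Mc0; have := Pmin (c i) _ Mcn.
  rewrite !cD subr0 distrC !ger0_norm ?subr_ge0 ?ler_nat //.
  have -> : (n%:R - i%:R) / n%:R = 1 - i%:R / n%:R :> R by field; rewrite gt_eqF.
  set e := _ / n%:R; nra.
(* Any value strictly between [2 D] and [r] would do; strictness keeps [rho]
   positive when [x = y]. *)
pose rho := (2 * D + r) / 2.
have rho0r : 0 < rho < r by rewrite /rho; apply/andP; split; lra.
have Pc i : (i < n)%N -> enorm (P (c i) - P (c i.+1)) <= 4 / 3 * (D / n%:R).
  move=> lin.
  have Drho : D / 2 / rho <= 4^-1.
    by rewrite ler_pdivrMr /rho; lra.
  have := @projection_lipschitz R N M P cM MP Pmin r Puniq (c i) (c i.+1)
    rho (D / 2) rho0r (dc _ (ltnW lin)) (dc _ lin).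
  have -> : enorm (c i - c i.+1) = D / n%:R.
    by rewrite cD -natr1 opprD addrA subrr add0r normrN1 mul1r mulrC.
  move: (D / n%:R) (enorm_ge0 (P (c i) - P (c i.+1))) Drho => Dn.
  set e := enorm _; set k := _ / rho => e0 k4 h.
  have := h _; rewrite /rho; nra.
have arcs i : (i < n)%N -> smooth_arc M (2 * D / n%:R) (P (c i)) (P (c i.+1)).
  move=> lin.
  have [g [g0 g1 sg Mg gK]] := arcM _ _ (MP (c i)) (MP (c i.+1))
    (le_lt_trans (Pc i lin) nD).
  exists g; split => // s t s01 t01; apply: le_trans (gK s t s01 t01) _.
  by rewrite ler_wpM2r //; have := Pc i lin; lra.
have := @geodesic_dist_le_chain R N M (2 * D / n%:R) (fun i => P (c i)) n _
  (MP _) n0 arcs.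
rewrite c0 cn !PM // divfK ?gt_eqF //; apply.
by rewrite !mulr_ge0 // invr_ge0.
Qed.
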